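(* For each prime $p$, there exists a locally finite $p$-group which is mixed identity-free (MIF).
   Context: For a group $G$ and a free group $F$ (on a basis $\{x,y,\ldots\}$), let $G \ast F$ be the free product. The group $G$ satisfies the mixed identity $w=1$, where $w \in G \ast F$, if for every homomorphism $\varepsilon : G \ast F \to G$ that restricts to the identity on $G$ one has $\varepsilon(w)=1$. The mixed identity $w=1$ is nontrivial if $w$ is a nontrivial element of $G \ast F$. The group $G$ is mixed identity-free (MIF) if it satisfies no nontrivial mixed identity; i.e. for every $n \in \mathbb{N}$ and every nontrivial $w \in G \ast F_n$ ($F_n$ free of rank $n$) there is a homomorphism $\varphi : G \ast F_n \to G$ that is the identity on $G$ and satisfies $\varphi(w) \neq 1$. A locally finite $p$-group is a group in which every finitely generated subgroup is a finite $p$-group. *)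

(* Defs.v *)
From HB Require Import structures.
From mathcomp Require Import all_boot.
From mathcomp Require Import boolp classical_sets functions cardinality.

Set Implicit Arguments.
Unset Strict Implicit.
Unset Printing Implicit Defensive.

Import Algebra.
Local Open Scope quotient_scope.
Local Open Scope group_scope.

Notation group_hom := UMagmaMorphism.type.

(* The monoid presented by letters T and relations u = v for R u v, as the    *)
(* quotient of the free monoid seq T by the congruence generated by R.        *)
Section Presentation.
Variables (T : choiceType) (R : seq T -> seq T -> Prop).

Inductive word_cong : seq T -> seq T -> Prop :=
| word_cong_rel s u v t : R u v -> word_cong (s ++ u ++ t) (s ++ v ++ t)
| word_cong_refl u : word_cong u u
| word_cong_sym u v : word_cong u v -> word_cong v u
| word_cong_trans v u w : word_cong u v -> word_cong v w -> word_cong u w.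

Definition word_congb (u v : seq T) : bool := `[< word_cong u v >].

Fact word_congb_is_equiv : equiv_class_of word_congb.
Proof.
split=> [u|u v|v u w]; first exact/asboolP/word_cong_refl.
  by apply/asboolP/asboolP; apply: word_cong_sym.
by move=> /asboolP uv /asboolP vw; apply/asboolP/(word_cong_trans uv vw).
Qed.

Canonical word_congb_equiv := EquivRelPack word_congb_is_equiv.

Definition presented : Type := {eq_quot word_congb}.
HB.instance Definition _ := Choice.on presented.

Definition word_class (u : seq T) : presented := \pi_{eq_quot word_congb} u.

Lemma word_classP u v : word_class u = word_class v <-> word_cong u v.
Proof. by split=> [/eqmodP/asboolP|uv]; [|apply/eqmodP/asboolP]. Qed.

Lemma word_class_surj (x : presented) : exists u, x = word_class u.
Proof. by exists (repr x); rewrite /word_class reprK. Qed.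

Lemma word_cong_cat u v u' v' :
  word_cong u v -> word_cong u' v' -> word_cong (u ++ u') (v ++ v').
Proof.
have catl s a b : word_cong a b -> word_cong (s ++ a) (s ++ b).
  elim=> [s' a' b' t' r|a'|a' b' _|b' a' c' _ + _].
  - by rewrite !(catA s s'); apply: word_cong_rel.
  - exact: word_cong_refl.
  - exact: word_cong_sym.
  - exact: word_cong_trans.
have catr t a b : word_cong a b -> word_cong (a ++ t) (b ++ t).
  elim=> [s' a' b' t' r|a'|a' b' _|b' a' c' _ + _].
  - by rewrite -!catA; apply: word_cong_rel.
  - exact: word_cong_refl.
  - exact: word_cong_sym.
  - exact: word_cong_trans.
by move=> uv uv'; apply: (@word_cong_trans (v ++ u'));
  [apply: catr|apply: catl].
Qed.

Definition presented_mul (x y : presented) : presented :=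
  word_class (repr x ++ repr y).

Lemma presented_mulE u v :
  presented_mul (word_class u) (word_class v) = word_class (u ++ v).
Proof.
by apply/word_classP/word_cong_cat; apply/word_classP;
  rewrite /word_class reprK.
Qed.

Fact presented_mulA : associative presented_mul.
Proof.
move=> x y z; have [u ->] := word_class_surj x.
have [v ->] := word_class_surj y; have [w ->] := word_class_surj z.
by rewrite !presented_mulE catA.
Qed.

Fact presented_mul1g : left_id (word_class [::]) presented_mul.
Proof.
by move=> x; have [u ->] := word_class_surj x; rewrite presented_mulE.
Qed.

Fact presented_mulg1 : right_id (word_class [::]) presented_mul.
Proof.
by move=> x; have [u ->] := word_class_surj x; rewrite presented_mulE cats0.
Qed.

HB.instance Definition _ := isMonoid.Build presented
  presented_mulA presented_mul1g presented_mulg1.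

Lemma word_class_cat u v : word_class (u ++ v) = word_class u * word_class v.
Proof. by rewrite -presented_mulE. Qed.

Lemma word_class_cons a u :
  word_class (a :: u) = word_class [:: a] * word_class u.
Proof. by rewrite -word_class_cat. Qed.

Lemma word_class_rel u v : R u v -> word_class u = word_class v.
Proof.
move=> uv; apply/word_classP.
by have:= word_cong_rel [::] [::] uv; rewrite !cats0.
Qed.

(* A map of letters into a monoid that respects R extends to the quotient.    *)
Definition word_extend (M : monoidType) (f : T -> M) (x : presented) : M :=
  \prod_(a <- repr x) f a.

Section Extend.
Variables (M : monoidType) (f : T -> M).
Hypothesis fR :
  forall u v, R u v -> \prod_(a <- u) f a = \prod_(a <- v) f a.

Lemma word_extend_class u : word_extend f (word_class u) = \prod_(a <- u) f a.
Proof.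
have congE v w : word_cong v w -> \prod_(a <- v) f a = \prod_(a <- w) f a.
  elim=> [s v' w' t r|//|//|v' w' x' _ -> _ -> //].
  by rewrite !big_cat /= (fR r).
by apply/congE/word_classP; rewrite /word_class reprK.
Qed.

Fact word_extend_morphism : monoid_morphism (word_extend f).
Proof.
split=> [|x y]; first by rewrite word_extend_class big_nil.
have [u ->] := word_class_surj x; have [v ->] := word_class_surj y.
by rewrite -word_class_cat !word_extend_class big_cat.
Qed.
End Extend.

(* Letterwise inversion i makes the presented monoid a group.                 *)
Section Inverse.
Variable i : T -> T.
Hypothesis iV : forall a, word_class [:: i a; a] = 1.
Hypothesis Vi : forall a, word_class [:: a; i a] = 1.

Definition presented_inv (x : presented) : presented :=
  word_class (rev (map i (repr x))).

Fact presented_mulVg : left_inverse 1 presented_inv *%g.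
Proof.
move=> x; rewrite -{2}[x]reprK -/(word_class _) -word_class_cat.
elim: (repr x) => [|a u IHu] //=.
rewrite rev_cons cat_rcons -[i a :: _]/([:: i a; a] ++ u).
by rewrite !word_class_cat iV mul1g -word_class_cat.
Qed.

Fact presented_mulgV : right_inverse 1 presented_inv *%g.
Proof.
move=> x; rewrite -{1}[x]reprK -/(word_class _) -word_class_cat.
elim/last_ind: (repr x) => [|u a IHu] //=.
rewrite map_rcons rev_rcons cat_rcons -[a :: _]/([:: a; i a] ++ _).
by rewrite !word_class_cat Vi mul1g -word_class_cat.
Qed.
End Inverse.

End Presentation.

(* Free group on X: the letter (x, false) stands for x, (x, true) for x^-1.   *)
Section FreeGroup.
Variable X : choiceType.

Variant free_group_rel : seq (X * bool) -> seq (X * bool) -> Prop :=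
| FreeGroupRel x b : free_group_rel [:: (x, b); (x, ~~ b)] [::].

Definition free_group : Type := presented free_group_rel.
HB.instance Definition _ := Monoid.on free_group.

Let opp (a : X * bool) := (a.1, ~~ a.2).

Fact free_group_Vi a : word_class free_group_rel [:: a; opp a] = 1.
Proof. by case: a => x b; apply: word_class_rel. Qed.

Fact free_group_iV a : word_class free_group_rel [:: opp a; a] = 1.
Proof.
case: a => x b; apply: word_class_rel.
by rewrite -{2}[b]negbK; apply: FreeGroupRel.
Qed.

HB.instance Definition _ := hasInv.Build free_group (presented_inv opp).
HB.instance Definition _ := Monoid_isGroup.Build free_group
  (presented_mulVg free_group_iV) (presented_mulgV free_group_Vi).

Definition free_gen (x : X) : free_group :=
  word_class free_group_rel [:: (x, false)].

Lemma free_group_universal (K : groupType) (f : X -> K) :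
  exists2 phi : group_hom free_group K,
    (forall x, phi (free_gen x) = f x) &
    forall psi : group_hom free_group K,
      (forall x, psi (free_gen x) = f x) -> psi =1 phi.
Proof.
pose h (a : X * bool) := if a.2 then (f a.1)^-1 else f a.1.
have hR u v : free_group_rel u v -> \prod_(a <- u) h a = \prod_(a <- v) h a.
  by case=> x []; rewrite !big_cons !big_nil /h /= mulg1 ?mulgV ?mulVg.
pose m := isUMagmaMorphism.Build free_group K _ (word_extend_morphism hR).
pose phi : group_hom free_group K :=
  HB.pack (word_extend h : free_group -> K) m.
exists phi => [x|psi psif z].
  by rewrite [LHS](word_extend_class hR) big_seq1.
have [u ->] := word_class_surj z.
rewrite [RHS](word_extend_class hR); elim: u => [|[x b] u IHu].
  by rewrite big_nil; exact: gmulf1.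
rewrite big_cons -IHu word_class_cons gmulfM; congr (_ * _).
case: b; last exact: psif.
rewrite /h /= -psif -gmulfV; congr (psi _).
apply: (mulIg (free_gen x)); rewrite mulVg.
by rewrite -[LHS]word_class_cat; exact: (free_group_iV (x, false)).
Qed.

End FreeGroup.

(* Free product: letters from G and H, with the multiplication tables of G    *)
(* and H as relations.                                                        *)
Section FreeProduct.
Variables G H : groupType.

Variant free_product_rel : seq (G + H) -> seq (G + H) -> Prop :=
| FreeProductL1 : free_product_rel [:: inl 1] [::]
| FreeProductR1 : free_product_rel [:: inr 1] [::]
| FreeProductLM x y : free_product_rel [:: inl x; inl y] [:: inl (x * y)]
| FreeProductRM x y : free_product_rel [:: inr x; inr y] [:: inr (x * y)].

Definition free_product : Type := presented free_product_rel.
HB.instance Definition _ := Monoid.on free_product.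

Let opp (a : G + H) : G + H :=
  match a with inl x => inl x^-1 | inr y => inr y^-1 end.

Fact free_product_Vi a : word_class free_product_rel [:: a; opp a] = 1.
Proof.
case: a => x /=.
  rewrite (word_class_rel (FreeProductLM _ _)) mulgV.
  exact/word_class_rel/FreeProductL1.
rewrite (word_class_rel (FreeProductRM _ _)) mulgV.
exact/word_class_rel/FreeProductR1.
Qed.

Fact free_product_iV a : word_class free_product_rel [:: opp a; a] = 1.
Proof.
case: a => x /=.
  rewrite (word_class_rel (FreeProductLM _ _)) mulVg.
  exact/word_class_rel/FreeProductL1.
rewrite (word_class_rel (FreeProductRM _ _)) mulVg.
exact/word_class_rel/FreeProductR1.
Qed.

HB.instance Definition _ := hasInv.Build free_product (presented_inv opp).
HB.instance Definition _ := Monoid_isGroup.Build free_product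
  (presented_mulVg free_product_iV) (presented_mulgV free_product_Vi).

Definition free_inl (x : G) : free_product :=
  word_class free_product_rel [:: inl x].
Definition free_inr (y : H) : free_product :=
  word_class free_product_rel [:: inr y].

Fact free_inl_morphism : monoid_morphism free_inl.
Proof.
split=> [|x y]; first exact/word_class_rel/FreeProductL1.
rewrite /free_inl -(word_class_rel (FreeProductLM _ _)).
exact: (word_class_cat _ [:: _]).
Qed.

Fact free_inr_morphism : monoid_morphism free_inr.
Proof.
split=> [|x y]; first exact/word_class_rel/FreeProductR1.
rewrite /free_inr -(word_class_rel (FreeProductRM _ _)).
exact: (word_class_cat _ [:: _]).
Qed.

HB.instance Definition _ := isUMagmaMorphism.Build G free_product
  free_inl free_inl_morphism.
HB.instance Definition _ := isUMagmaMorphism.Build H free_product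
  free_inr free_inr_morphism.

Lemma free_product_universal (K : groupType)
    (f : group_hom G K) (g : group_hom H K) :
  exists2 phi : group_hom free_product K,
    (forall x, phi (free_inl x) = f x) /\ (forall y, phi (free_inr y) = g y) &
    forall psi : group_hom free_product K,
      (forall x, psi (free_inl x) = f x) ->
      (forall y, psi (free_inr y) = g y) -> psi =1 phi.
Proof.
pose h (a : G + H) := match a with inl x => f x | inr y => g y end.
have hR u v : free_product_rel u v ->
    \prod_(a <- u) h a = \prod_(a <- v) h a.
  case=> [||x y|x y]; rewrite !big_cons !big_nil /h ?mulg1.
  - exact: gmulf1.
  - exact: gmulf1.
  - by rewrite gmulfM.
  - by rewrite gmulfM.
pose m := isUMagmaMorphism.Build free_product K _ (word_extend_morphism hR).
pose phi : group_hom free_product K :=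
  HB.pack (word_extend h : free_product -> K) m.
exists phi => [|psi psif psig z].
  by split=> x; rewrite [LHS](word_extend_class hR) big_seq1.
have [u ->] := word_class_surj z.
rewrite [RHS](word_extend_class hR); elim: u => [|a u IHu].
  by rewrite big_nil; exact: gmulf1.
rewrite big_cons -IHu word_class_cons gmulfM; congr (_ * _).
by case: a => x; [exact: psif|exact: psig].
Qed.

End FreeProduct.

Definition mixed_identity_free (G : groupType) : Prop :=
  forall (n : nat) (w : free_product G (free_group 'I_n)), w <> 1 ->
  exists phi : group_hom (free_product G (free_group 'I_n)) G,
    (forall g, phi (free_inl _ g) = g) /\ phi w <> 1.

Local Open Scope classical_set_scope.
Local Open Scope card_scope.

Definition subgroup_generated (G : groupType) (A : set G) : set G :=
  smallest (fun H : set G => group_closed [in H]) A.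

Definition has_p_power_order (G : groupType) (p : nat) (H : set G) : Prop :=
  exists k : nat, H #= `I_(p ^ k)%N.

Definition locally_finite_p_group (p : nat) (G : groupType) : Prop :=
  forall A : set G, finite_set A ->
    has_p_power_order p (subgroup_generated A).

(* Main.v *)
(* Let [T_0] be the cyclic group of order [p] and let [T_(m+1)] be the        *)
(* semidirect product of the functions ['I_m * T_m -> T_0] with [T_m], i.e.   *)
(* the wreath product of [T_0 ^ m] with [T_m]. The group is the union of the  *)
(* [T_m], each embedded in the next as the top group; it is locally a finite  *)
(* [p]-group by Lagrange.                                                     *)
(* Given a mixed word [w] with constants in [T_k], define                     *)
(* [h_(m+1, i) = (delta_(i, 1), h_(m, i))]. The base component of [w(h_(m+1))]*)
(* counts the passages through the edges [(i, z)] of the path that            *)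
(* [w(h_m)] traces on the vertex set [T_m] (Fox calculus). If a reduced word  *)
(* shorter than [w] never gives a closed path in [T_m], then [w] traverses    *)
(* its first edge only once, so [w(h_(m+1)) <> 1]. By induction on the length *)
(* [w(h_m) <> 1] as soon as [m >= k + length w].                              *)

From HB Require Import structures.
Require Import Defs.
From mathcomp Require Import all_boot fingroup zmodp pgroup.
From mathcomp Require Import boolp classical_sets functions cardinality.

Set Implicit Arguments.
Unset Strict Implicit.
Unset Printing Implicit Defensive.

Import Algebra.
Local Open Scope group_scope.

(** The limit is a locally finite [p]-group because finitely many of its elements lie in one
    [stage K], where [proj K] is injective into the finite [p]-group [tower K]
    ([limit_locally_finite]). It is MIF because a mixed word has a reduced form
    ([free_product_reduced_word]) whose constants again lie in one stage. Substituting deltas in a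
    wreath product makes the value record the path traced one level below ([wreath_word_neq1]), so
    each level of the tower pays for one more letter ([limit_word_neq1]). The substituted elements
    depend on the word through the truncation level [M]. *)

(** * Mixed words and their reduced form *)

Section Words.
Variables (J : eqType) (C : groupType).
Implicit Types (j : J) (e : bool) (s : seq (J * bool * C)).

Definition signed (K : groupType) e (x : K) : K := if e then x^-1 else x.

(* A triple [(j, e, g)] stands for the syllable [x_j^(+-1) g], the exponent   *)
(* being negative when [e] is true.                                           *)
Definition word_value (K : groupType) (c : C -> K) (h : J -> K) s : K :=
  \prod_(a <- s) (signed a.1.2 (h a.1.1) * c a.2).

Definition no_cancel (a b : J * bool * C) : bool :=
  ~~ [&& a.1.1 == b.1.1, b.1.2 == ~~ a.1.2 & a.2 == 1].

Definition reduced s : bool := sorted no_cancel s.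

Lemma word_value_cons (K : groupType) (c : C -> K) (h : J -> K) a s :
  word_value c h (a :: s) =
    signed a.1.2 (h a.1.1) * c a.2 * word_value c h s.
Proof. by rewrite /word_value big_cons. Qed.

Lemma gmulf_signed (K L : groupType) (phi : group_hom K L) e x :
  phi (signed e x) = signed e (phi x).
Proof. by case: e => //=; rewrite gmulfV. Qed.

Lemma gmulf_word_value (K L : groupType) (phi : group_hom K L) c h s :
  phi (word_value c h s) = word_value (phi \o c) (phi \o h) s.
Proof.
rewrite /word_value gmulf_prod; apply: eq_bigr => a _.
by rewrite gmulfM gmulf_signed.
Qed.

Lemma eq_word_value (K : groupType) (c c' : C -> K) (h h' : J -> K) s :
  c =1 c' -> h =1 h' -> word_value c h s = word_value c' h' s.
Proof. by move=> cE hE; apply: eq_bigr => a _; rewrite cE hE. Qed.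

End Words.

(** Such products are stable under left multiplication by constants and by letters: a new letter
    either leaves the word reduced or cancels against its first syllable. *)
Lemma free_product_reduced_word (G : groupType) (J : choiceType)
    (w : free_product G (free_group J)) :
  exists g s, reduced s /\
    w = free_inl _ g *
      word_value (@free_inl G _) (@free_inr G _ \o @free_gen J) s.
Proof.
set c := @free_inl G _; set h := _ \o _.
pose P w := exists g s, reduced s /\ w = c g * word_value c h s.
have [c1 cM] : c 1 = 1 /\ {morph c : x y / x * y}.
  by split; [exact: gmulf1|exact: gmulfM].
have rM (y z : free_group J) :
    free_inr G (y * z) = free_inr G y * free_inr G z by exact: gmulfM.
have Pl g z : P z -> P (c g * z).
  by move=> [g' [s [rs ->]]]; exists (g * g'), s; rewrite cM mulgA.
have Px e j z : P z -> P (signed e (h j) * z).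
  move=> [g [s [rs ->]]].
  have [|rs'] := boolP (reduced ((j, e, g) :: s)).
    exists 1, ((j, e, g) :: s); split=> //.
    by rewrite word_value_cons c1 mul1g mulgA.
  case: s rs rs' => [//|[[j' e'] g'] s] /= rs.
  rewrite rs andbT negbK /= => /and3P[/eqP <- /eqP -> /eqP ->].
  exists g', s; split; first exact: path_sorted rs.
  rewrite word_value_cons /= c1 mul1g !mulgA.
  by case: (e); rewrite /= ?mulVg ?mulgV mul1g.
have Pr y z : P z -> P (free_inr _ y * z).
  move=> Pz; have [v ->] := word_class_surj y.
  elim: v => [|[j e] v IHv].
    by rewrite -/(1 : free_group J) gmulf1 mul1g.
  rewrite word_class_cons rM -mulgA.
  suff -> : free_inr G (word_class _ [:: (j, e)] : free_group J)
            = signed e (h j) by exact: Px.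
  rewrite -gmulf_signed; congr (free_inr _ _); case: e => //=.
  apply: (mulIg (free_gen j)); rewrite mulVg.
  by rewrite -[LHS]word_class_cat; exact: (free_group_iV (j, false)).
have [u ->] := word_class_surj w.
elim: u => [|[g|y] u IHu].
- by exists 1, [::]; rewrite /word_value big_nil c1 mulg1.
- by rewrite word_class_cons; apply: Pl.
- by rewrite word_class_cons; apply: Pr.
Qed.

(** * Wreath products and detection of nontrivial words *)

Section Wreath.
Variables (I : finType) (Q T : finGroupType).

Definition wreath : Type := ({ffun I * T -> Q} * T)%type.
HB.instance Definition _ := Finite.on wreath.
Implicit Types x y : wreath.

Definition wr_base x : {ffun I * T -> Q} := x.1.
Definition wr_top x : T := x.2.

Definition wr_mul x y : wreath :=
  ([ffun k => wr_base x k * wr_base y (k.1, (wr_top x)^-1 * k.2)],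
   wr_top x * wr_top y).
Definition wr_one : wreath := ([ffun=> 1], 1).
Definition wr_inv x : wreath :=
  ([ffun k => (wr_base x (k.1, wr_top x * k.2))^-1], (wr_top x)^-1).

Fact wr_mulA : associative wr_mul.
Proof.
move=> x y z; congr (_, _); last exact: mulgA.
by apply/ffunP=> k; rewrite !ffunE /= invMg !mulgA.
Qed.

Fact wr_mul1 : left_id wr_one wr_mul.
Proof.
move=> [b g]; congr (_, _); last exact: mul1g.
by apply/ffunP=> -[i z]; rewrite !ffunE /= invg1 !mul1g.
Qed.

Fact wr_mulV : left_inverse wr_one wr_inv wr_mul.
Proof.
move=> x; congr (_, _); last exact: mulVg.
by apply/ffunP=> k; rewrite !ffunE /= invgK mulVg.
Qed.

HB.instance Definition _ := Finite_isGroup.Build wreath wr_mulA wr_mul1 wr_mulV.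

Lemma wr_topM : {morph wr_top : x y / x * y}. Proof. by []. Qed.

Lemma wr_baseM x y i z :
  wr_base (x * y) (i, z) = wr_base x (i, z) * wr_base y (i, (wr_top x)^-1 * z).
Proof. by rewrite [LHS]ffunE. Qed.

Lemma wr_baseV x i z :
  wr_base x^-1 (i, z) = (wr_base x (i, wr_top x * z))^-1.
Proof. by rewrite [LHS]ffunE. Qed.

Lemma wr_base1 k : wr_base (1 : wreath) k = 1.
Proof. by rewrite [LHS]ffunE. Qed.

Definition wr_lift (g : T) : wreath := ([ffun=> 1], g).

Lemma wr_liftM : {morph wr_lift : g h / g * h}.
Proof.
by move=> g h; congr (_, _); apply/ffunP=> k; rewrite !ffunE mulg1.
Qed.

Lemma card_wreath : #|{: wreath}| = (#|Q| ^ (#|I| * #|T|) * #|T|)%N.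
Proof. by rewrite card_prod card_ffun card_prod. Qed.

Lemma wreath_pgroup p : p.-group [set: Q] -> p.-group [set: T] ->
  p.-group [set: wreath].
Proof. by rewrite /pgroup !cardsT card_wreath pnatM pnatX => -> ->. Qed.

Section Detect.
Variables (J : eqType) (C : groupType) (S : {pred C}) (c : C -> T).
Variables (h : J -> T) (f : J -> I) (q : Q).
Hypotheses (S1 : 1 \in S) (c1 : c 1 = 1).
Hypothesis c_inj1 : forall g, g \in S -> c g = 1 -> g = 1.
Hypotheses (f_inj : injective f) (q_neq1 : q != 1).

Definition wr_delta i : {ffun I * T -> Q} :=
  [ffun k => if (k.1 == i) && (k.2 == 1) then q else 1].

Let t j : wreath := (wr_delta (f j), h j).
Let value := word_value c h.
Let wvalue := word_value (wr_lift \o c) t.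

(* An edge [(j, z)] goes from [z] to [z * h j]; an inverse letter read from   *)
(* [y] traverses backwards the edge that ends at [y].                         *)
Let edge (y : T) (a : J * bool * C) : J * T :=
  (a.1.1, if a.1.2 then y * (h a.1.1)^-1 else y).

(** Product rule of Fox calculus: the first syllable contributes at the edge it traverses, and the
    rest is read from the vertex it leads to. Injectivity of [f] keeps the edges of distinct
    variables apart. *)
Let wvalue_step (y : T) a s j z :
  wr_base (wr_lift y * wvalue (a :: s)) (f j, z) =
  (if edge y a == (j, z) then signed a.1.2 q else 1) *
  wr_base (wr_lift (y * (signed a.1.2 (h a.1.1) * c a.2)) * wvalue s) (f j, z).
Proof.
rewrite /wvalue word_value_cons -/(wvalue s) !wr_baseM.
have -> : wr_top (signed a.1.2 (t a.1.1) * wr_lift (c a.2)) =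
    signed a.1.2 (h a.1.1) * c a.2 by rewrite wr_topM; case: (a.1.2).
rewrite !ffunE !mul1g mulg1 !invMg !mulgA; congr (_ * _).
have delta j' z' : wr_base (t j') (f j, z') =
    if (j' == j) && (z' == 1) then q else 1.
  by rewrite ffunE /= (inj_eq f_inj) [j == _]eq_sym.
rewrite /edge xpair_eqE /signed; case: (a.1.2); last first.
  by rewrite delta -eq_invg_mul invgK.
have topt : wr_top (t a.1.1) = h a.1.1 by [].
rewrite wr_baseV delta topt mulgA -eq_invg_mul invMg invgK.
by case: ifP; rewrite ?invg1.
Qed.

Let wvalue_base1 (y : T) s j z :
  (forall s1 a s2, s = s1 ++ a :: s2 -> edge (y * value s1) a <> (j, z)) ->
  wr_base (wr_lift y * wvalue s) (f j, z) = 1.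
Proof.
elim: s y => [|a s IHs] y nedge.
  by rewrite /wvalue /word_value big_nil mulg1 ffunE.
rewrite wvalue_step ifN ?mul1g; last first.
  apply/eqP; have := nedge [::] a s erefl.
  by rewrite /value /word_value big_nil mulg1.
apply: IHs => s1 b s2 sE; rewrite -mulgA -word_value_cons.
by apply: (nedge (a :: s1) b s2); rewrite sE.
Qed.

(* The first edge is traversed only once: between two traversals of it, the   *)
(* word would have a proper subword describing a closed path.                 *)
Lemma wreath_word_neq1 g s :
  reduced s -> s != [::] -> all (fun a => a.2 \in S) s ->
  (forall g' s', g' \in S -> reduced s' -> s' != [::] ->
     all (fun a => a.2 \in S) s' -> (size s' < size s)%N ->
     c g' * value s' <> 1) ->
  wr_lift (c g) * wvalue s <> 1.
Proof.
case: s => [//|a s] rs _ /= /andP[aS sS] closed_long eq1.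
have := wr_base1 (f (edge (c g) a).1, (edge (c g) a).2).
rewrite -eq1 wvalue_step -surjective_pairing eqxx wvalue_base1.
  rewrite mulg1; case: (a.1.2) => /= /eqP; last by apply/negP.
  by rewrite invg_eq1; apply/negP.
move=> s1 b s2 sE.
have [rs1 rs1'] : reduced (a :: s1) /\ reduced s1.
  by move: rs; rewrite sE -cat_cons => /cat_sorted2[/[dup] /path_sorted].
have s1S : all (fun a => a.2 \in S) s1.
  by move: sS; rewrite sE all_cat => /andP[].
have lt_s1 : (size s1 < size s)%N.
  by rewrite sE size_cat addnS ltnS leq_addr.
(* If [a] and [b] traverse the edge in the same direction, [a :: s1] describes a closed path. *)
have same : value (a :: s1) <> 1.
  have := closed_long 1 (a :: s1) S1 rs1 isT.
  by rewrite /= aS s1S c1 mul1g; apply.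
(* In opposite directions, [s1] preceded by the constant [a.2] is closed; if [s1] is empty, [a]
   cancels against [b]. *)
have opposite : a.1.1 = b.1.1 -> b.1.2 = ~~ a.1.2 -> c a.2 * value s1 <> 1.
  move=> ji eb; have [s1E|s1n] := eqVneq s1 [::].
    rewrite s1E /value /word_value big_nil mulg1 => /(c_inj1 aS) a1.
    by move: rs; rewrite sE s1E /= /no_cancel ji eb a1 !eqxx.
  by apply: closed_long => //; apply: leqW.
case: a b same opposite {rs eq1 sE rs1 aS} => [[i e] a] [[i' e'] b] same opp.
rewrite /edge /= => -[ii]; rewrite ii in same opp *.
move: same opp; rewrite /value word_value_cons -/value.
move: (value s1) => v /= same /(_ erefl) opp.
have cancel (u x : T) : c g * x * v = c g * u -> u^-1 * x * v = 1.
  by rewrite -!mulgA => /mulgI ->; rewrite mulVg.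
case: e e' same opp => [] [] /= same opp.
- move=> /mulIg E; apply: same.
  by have := cancel 1 _ (etrans E (esym (mulg1 _))); rewrite invg1 mul1g.
- by move=> /cancel; rewrite mulgA mulVg mul1g; apply: (opp erefl).
- move=> /(canRL (mulgVK _)) /cancel; rewrite mulgA mulVg mul1g.
  exact: (opp erefl).
- move=> E; apply: same.
  by have := cancel 1 _ (etrans E (esym (mulg1 _))); rewrite invg1 mul1g.
Qed.

End Detect.

End Wreath.

(** * The tower and its direct limit *)

Section Tower.
Variable Q : finGroupType.

Fixpoint tower (m : nat) : finGroupType :=
  if m is m'.+1 then wreath 'I_m' Q (tower m') else Q.

Definition tower_top m (x : tower m.+1) : tower m :=
  @wr_top 'I_m Q (tower m) x.

Definition tower_lift m (x : tower m) : tower m.+1 :=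
  @wr_lift 'I_m Q (tower m) x.

Lemma tower_liftM m : {morph @tower_lift m : x y / x * y}.
Proof. exact: wr_liftM. Qed.

Lemma tower_lift1 m : tower_lift (1 : tower m) = 1. Proof. by []. Qed.

Lemma tower_liftV m : {morph @tower_lift m : x / x^-1}.
Proof.
move=> x; apply: (mulIg (tower_lift x)).
by rewrite -tower_liftM !mulVg tower_lift1.
Qed.

Lemma tower_pgroup p m : p.-group [set: Q] -> p.-group [set: tower m].
Proof. by move=> pQ; elim: m => // m; apply: wreath_pgroup. Qed.

Definition stable_from K (x : forall m, tower m) : Prop :=
  forall m, (K <= m)%N -> x m.+1 = tower_lift (x m).

(* The direct limit of the tower along [tower_lift], realized inside the      *)
(* inverse limit along [tower_top], of which [tower_lift] is a section.       *)
Record limit : Type := Limit {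
  component :> forall m, tower m;
  component_top : forall m, tower_top (component m.+1) = component m;
  component_stable : exists K, stable_from K component
}.

HB.instance Definition _ := gen_eqMixin limit.
HB.instance Definition _ := gen_choiceMixin limit.

Lemma limit_eq (x y : limit) : (forall m, x m = y m) -> x = y.
Proof.
case: x y => [x xt xs] [y yt ys] /= xy.
have {}xy : x = y by apply: functional_extensionality_dep.
by subst y; congr Limit; apply: Prop_irrelevance.
Qed.

Lemma stable_fromW K L x : (K <= L)%N -> stable_from K x -> stable_from L x.
Proof. by move=> KL xK m Lm; apply/xK/(leq_trans KL). Qed.

Fact limit_mul_stable (x y : limit) :
  exists K, stable_from K (fun m => x m * y m).
Proof.
have [K xK] := component_stable x; have [L yL] := component_stable y.
exists (maxn K L) => m; rewrite geq_max => /andP[Km Lm].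
by rewrite xK // yL // tower_liftM.
Qed.

Fact limit_inv_stable (x : limit) : exists K, stable_from K (fun m => (x m)^-1).
Proof.
by have [K xK] := component_stable x; exists K => m /xK ->; rewrite tower_liftV.
Qed.

Definition limit_mul (x y : limit) : limit.
Proof.
apply: (@Limit (fun m => x m * y m)) (limit_mul_stable x y) => m.
by rewrite -[in RHS](component_top x) -[in RHS](component_top y).
Defined.

Definition limit_inv (x : limit) : limit.
Proof.
apply: (@Limit (fun m => (x m)^-1)) (limit_inv_stable x) => m.
by rewrite -[in RHS](component_top x).
Defined.

Definition limit_one : limit.
Proof. by apply: (@Limit (fun m => 1)) => //; exists 0%N. Defined.

Fact limit_mulA : associative limit_mul.
Proof. by move=> x y z; apply: limit_eq => m; apply: mulgA. Qed.
Fact limit_mul1 : left_id limit_one limit_mul.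
Proof. by move=> x; apply: limit_eq => m; apply: mul1g. Qed.
Fact limit_1mul : right_id limit_one limit_mul.
Proof. by move=> x; apply: limit_eq => m; apply: mulg1. Qed.
Fact limit_mulV : left_inverse limit_one limit_inv limit_mul.
Proof. by move=> x; apply: limit_eq => m; apply: mulVg. Qed.
Fact limit_Vmul : right_inverse limit_one limit_inv limit_mul.
Proof. by move=> x; apply: limit_eq => m; apply: mulgV. Qed.

HB.instance Definition _ := isGroup.Build limit
  limit_mulA limit_mul1 limit_1mul limit_mulV limit_Vmul.

Definition proj m (x : limit) : tower m := x m.
Fact proj_morphism m : monoid_morphism (proj m). Proof. by []. Qed.
HB.instance Definition _ m := isUMagmaMorphism.Build limit (tower m)
  (proj m) (proj_morphism m).

Definition stage K : {pred limit} :=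
  fun x => `[< stable_from K (component x) >].

Lemma stageP K (x : limit) : reflect (stable_from K x) (x \in stage K).
Proof. exact: asboolP. Qed.

Lemma stage_group_closed K : group_closed (stage K).
Proof.
split; first exact/stageP.
move=> x y /stageP xK /stageP yK; apply/stageP => m Km.
by rewrite /= xK // yK // tower_liftM tower_liftV.
Qed.

Lemma stage_exists (s : list limit) : exists K, all (mem (stage K)) s.
Proof.
elim: s => [|x s [K sK]]; first by exists 0%N.
have [L xL] := component_stable x; exists (maxn K L) => /=; apply/andP; split.
  by apply/stageP; apply: stable_fromW xL; apply: leq_maxr.
apply: sub_all sK => y /stageP yK.
by apply/stageP; apply: stable_fromW yK; apply: leq_maxl.
Qed.

(** Agreement at level [K] propagates upwards by stability and downwards by [tower_top]. *)
Lemma proj_inj K : {in stage K &, injective (proj K)}.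
Proof.
move=> x y /stageP xK /stageP yK eqK; apply: limit_eq => m.
have up d : x (K + d)%N = y (K + d)%N.
  elim: d => [|d IHd]; first by rewrite addn0.
  by rewrite addnS xK ?yK ?leq_addr // IHd.
have down d : x (m + d)%N = y (m + d)%N -> x m = y m.
  elim: d => [|d IHd]; rewrite ?addn0 // addnS => E; apply: IHd.
  by rewrite -(component_top x) -(component_top y) E.
by apply: (down K); rewrite addnC.
Qed.

Lemma limit_locally_finite (p : nat) :
  p.-group [set: Q] -> locally_finite_p_group p limit.
Proof.
move=> pQ A /finite_fsetP[X AX].
have [K XK] := stage_exists (finmap.enum_fset X).
set H := subgroup_generated A.
have HK x : H x -> x \in stage K.
  move=> Hx; have /= := Hx [set` stage K]%classic; apply.
  split.
    have [S1 SD] := stage_group_closed K.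
    by split=> [|y z]; rewrite !inE; [exact: S1|exact: SD].
  by rewrite AX => y /= yX; apply: (allP XK).
have [H1 HD] : group_closed [in H].
  split=> [|x y]; rewrite !inE; first by move=> B [[B1 _] _]; rewrite inE in B1.
  move=> Hx Hy B /[dup] BA [[_ BD] _].
  by have := BD x y; rewrite !inE; apply; [exact: Hx|exact: Hy].
(* The image of [H] is a subgroup of a finite [p]-group, so Lagrange gives its order. *)
pose P : {set tower K} := [set t | `[< exists2 x, H x & proj K x = t >]].
have gP : group_set P.
  apply/group_setP; split=> [|t u]; rewrite !inE.
    by exists 1 => //; rewrite inE in H1.
  move=> [x Hx <-] [y Hy <-]; exists (x * y) => //.
  by apply: set_mem; apply: group_closedM; rewrite ?inE.
have /p_natP[k Pk] : p.-nat #|P|.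
  exact: (pgroupS (finset.subsetT (Group gP)) (tower_pgroup K pQ)).
exists k; rewrite -Pk.
have imH : (proj K @` H = (@enum_val _ (mem P)) @` setT)%classic.
  apply/seteqP; split=> [_ [x Hx <-]|_ [i _ <-]].
    have xP : proj K x \in P by rewrite !inE; exists x.
    by exists (enum_rank_in xP (proj K x)) => //; rewrite enum_rankK_in.
  by have := enum_valP i; rewrite !inE => -[x Hx xi]; exists x.
have projH : {in H &, injective (proj K)}.
  by move=> x y /set_mem Hx /set_mem Hy; apply: (@proj_inj K); apply: HK.
apply: (card_eq_trans (card_esym (inj_card_eq projH))); rewrite imH.
apply: (card_eq_trans _ (card_esym card_II)); apply: inj_card_eq.
by move=> i j _ _; apply: enum_val_inj.
Qed.

(* Truncating at [M] makes the sequence eventually constant.                  *)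
Fixpoint approx (q : Q) (M i m : nat) : tower m :=
  if m is m'.+1 then
    (if (m' < M)%N then oapp (wr_delta (tower m') q) [ffun=> 1] (insub i)
     else [ffun=> 1], approx q M i m')
  else 1.

Fact approx_stable q M i : stable_from M (approx q M i).
Proof. by move=> m Mm; congr (_, _); rewrite ltnNge Mm. Qed.

Definition limit_gen q M i : limit :=
  @Limit (approx q M i) (fun=> erefl) (ex_intro _ M (@approx_stable q M i)).

(** Induction on the level: a shorter word already has enough room one level down. Since [s] is
    nonempty, that lower level is still at least [m0], so [proj] is injective on the constants there
    and there are at least [n] indices. *)
Lemma limit_word_neq1 q M n m0 : q != 1 -> (n <= m0)%N ->
  forall m, (m <= M)%N -> forall (g : limit) (s : list ('I_n * bool * limit)),
  g \in stage m0 -> reduced s -> s != [::] ->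
  all (fun a => a.2 \in stage m0) s -> (m0 + size s <= m)%N ->
  proj m g * word_value (proj m) (fun i : 'I_n => approx q M i m) s <> 1.
Proof.
move=> q1 le_n; elim=> [|m IHm] leM g s gS rs sn sS.
  by case: s sn {rs sS} => // a s _; rewrite /= addnS.
move=> size_s.
have le_m : (m0 <= m)%N.
  rewrite -ltnS; apply: leq_trans size_s; case: s sn {rs sS} => // a s _.
  by rewrite addnS ltnS leq_addr.
have stage1 : 1 \in stage m0 by have [] := stage_group_closed m0.
have inj1 (x : limit) : x \in stage m0 -> proj m x = 1 -> x = 1.
  move=> /stageP xS x1; apply: (@proj_inj m) => //; apply/stageP => //.
  exact: stable_fromW xS.
have liftE (x : limit) : x \in stage m0 -> proj m.+1 x = wr_lift _ _ (proj m x).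
  by move=> /stageP; apply.
have f_inj : injective (widen_ord (leq_trans le_n le_m)).
  by move=> i j /(congr1 val) /= /val_inj.
have := @wreath_word_neq1 'I_m Q (tower m) 'I_n limit (stage m0) (proj m)
  (fun i => approx q M i m) (widen_ord (leq_trans le_n le_m)) q
  stage1 erefl inj1 f_inj q1 g s rs sn sS.
rewrite liftE //; set v := word_value _ _ _; set v' := word_value _ _ _.
have -> : v = v'.
  apply: eq_big_seq => a /(allP sS) aS; congr (signed _ _ * _).
    (* Level [m] is below the truncation and [a.1.1 < n <= m], so neither default of [approx]
       occurs. *)
    congr (_, _); rewrite leM.
    have a_lt : (a.1.1 < m)%N.
      by rewrite (leq_trans (ltn_ord _)) // (leq_trans le_n).
    by rewrite (insubT (fun k => k < m)%N a_lt); congr wr_delta; apply: val_inj.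
  by rewrite /= -liftE.
apply=> g' s' g'S rs' sn' s'S lt_s'; apply: IHm => //; first exact: ltnW.
by rewrite -ltnS (leq_trans _ size_s) // ltn_add2l.
Qed.

Lemma limit_mixed_identity_free : (1 < #|Q|)%N -> mixed_identity_free limit.
Proof.
move=> /card_gt1P[q1 [q2 [_ _ q12]]] n w.
have [q q_neq1] : exists q : Q, q != 1.
  by exists (q1 * q2^-1); rewrite -eq_mulgV1.
have [g [s [rs ->]]] := free_product_reduced_word w => w1.
have [K] := stage_exists (g :: [seq a.2 | a <- s]).
rewrite /= all_map => /andP[gK sK].
(* From level [m0] on, the constants are stable and the [n] variables have distinct indices;
   [size s] further levels serve the induction. *)
pose m0 := maxn K n; pose M := (m0 + size s)%N.
have KS x : x \in stage K -> x \in stage m0.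
  by move=> /stageP xK; apply/stageP; apply: stable_fromW xK; apply: leq_maxl.
have [phiF phiFE _] := free_group_universal (fun i : 'I_n => limit_gen q M i).
pose idm := isUMagmaMorphism.Build limit limit idfun
  (conj erefl (fun _ _ => erefl)).
pose idh : group_hom limit limit := HB.pack (idfun : limit -> limit) idm.
have [phi [phiL phiR] _] := free_product_universal idh phiF.
exists phi; split=> //.
rewrite gmulfM phiL gmulf_word_value.
rewrite (@eq_word_value _ _ _ _ id _ (fun i : 'I_n => limit_gen q M i));
  [|by move=> x /=; rewrite phiL|by move=> i /=; rewrite phiR phiFE].
(* Without variables the word is a constant, fixed by [phi]. *)
have [s0|sn] := eqVneq s [::].
  move: w1; rewrite s0 /word_value !big_nil !mulg1 => w1 g1.
  by apply: w1; rewrite [g]g1 gmulf1.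
move=> /(congr1 (proj M)); rewrite gmulfM gmulf_word_value.
apply: (limit_word_neq1 q_neq1 (leq_maxr K n) (leqnn M)) => //; first exact: KS.
by apply: sub_all sK => a; apply: KS.
Qed.

End Tower.

Theorem theorem1p3 (p : nat) (p_prime : prime p) :
  exists G : groupType, locally_finite_p_group p G /\ mixed_identity_free G.
Proof.
have p_gt1 := prime_gt1 p_prime; have p_gt0 := prime_gt0 p_prime.
(* The successor form gives the ordinals their cyclic group structure. *)
have card_Q : #|'I_p.-1.+1| = p by rewrite card_ord prednK.
exists (limit 'I_p.-1.+1); split.
  by apply: limit_locally_finite; rewrite // /pgroup cardsT card_Q pnat_id.
by apply: limit_mixed_identity_free; rewrite card_Q.
Qed.
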